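(* Let $A\in\mathbb{R}^{m\times n}$, $V_1\in\mathbb{R}^{n\times k}$, $V_2\in\mathbb{R}^{n\times p}$, and suppose $V=[V_1,V_2]$ satisfies $V^TV=I$. Let $K=VV^T$. First sample $S\sim\mathrm{DPP}(V_1V_1^T)$, and then (given $S$) sample $T\sim\mathrm{DPP}(\widetilde K)$, where $$\widetilde K=K-K(:,S)\,K(S,S)^{-1}K(S,:).$$ Let $U=[S,T]$. Then $$\mathbb{E}\left(\|A-A(:,U)\,V(U,:)^{-T}V^T\|_F^2\right)\le (1+k)(1+p)\,\|A-AVV^T\|_F^2.$$
   Context: For a matrix $M$ and index sets $I,J$, $M(I,J)$ is the submatrix with rows $I$ and columns $J$; $M(:,J)$ and $M(I,:)$ are the submatrices of all rows (resp. all columns). $M^{-T}=(M^{-1})^T$, and $\|\cdot\|_F$ is the Frobenius norm. $U=[S,T]$ is the index set obtained by concatenating the indices of $S$ and $T$; the same ordering of $U$ is used in $A(:,U)$ and $V(U,:)$. For a symmetric matrix $K\in\mathbb{R}^{n\times n}$ with $0\preceq K\preceq I$, $\mathrm{DPP}(K)$ (determinantal point process with kernel $K$) is the law of a random subset $X\subseteq\{1,\dots,n\}$ such that $\mathbb{P}(Y\subseteq X)=\det(K(Y,Y))$ for every $Y\subseteq\{1,\dots,n\}$. If $K$ is an orthogonal projector of rank $r$, then $|X|=r$ almost surely; in the setting of the claim, $|S|=k$ and $|T|=p$ almost surely. The expectation is over both $S$ and $T$. *)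

(* Defs.v *)
From HB Require Import structures.
From mathcomp Require Import all_boot all_order all_algebra.
From mathcomp Require Import all_classical all_reals all_analysis.

Set Implicit Arguments.
Unset Strict Implicit.
Unset Printing Implicit Defensive.

Import Order.TTheory GRing.Theory Num.Theory.

Local Open Scope classical_set_scope.
Local Open Scope ring_scope.

Section Matrices.
Context {R : realType}.

(* The norm that MathComp-Analysis puts on matrices is the sup norm. *)
Definition frobenius_norm m n (M : 'M[R]_(m, n)) : R :=
  Num.sqrt (\sum_(i < m) \sum_(j < n) M i j ^+ 2).

(* An index list of length q is a map 'I_q -> 'I_n, so that M(:,U) is
   colsub U M, M(U,:) is rowsub U M and M(I,J) is mxsub I J M.
   set_idx lists a subset in increasing order. *)
Definition set_idx n (S : {set 'I_n}) (i : 'I_#|S|) : 'I_n := enum_val i.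

Definition cat_idx n q1 q2 (f : 'I_q1 -> 'I_n) (g : 'I_q2 -> 'I_n)
    (i : 'I_(q1 + q2)) : 'I_n :=
  match fintype.split i with inl j => f j | inr j => g j end.

(* K - K(:,S) K(S,S)^-1 K(S,:) *)
Definition residual_kernel n (K : 'M[R]_n) (S : {set 'I_n}) : 'M[R]_n :=
  let s := @set_idx n S in
  K - colsub s K *m invmx (mxsub s s K) *m rowsub s K.

(* A(:,U) V(U,:)^-T V^T for an index list U of length q = r. The length of a
   random U equals r only almost surely, whence the casts by conform_mx: they
   are the identity up to the equation q = r, and give 0 when q <> r. *)
Definition oblique_approx m n r q (A : 'M[R]_(m, n)) (V : 'M[R]_(n, r))
    (U : 'I_q -> 'I_n) : 'M[R]_(m, n) :=
  let AU : 'M[R]_(m, r) := conform_mx 0 (colsub U A) in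
  let VU : 'M[R]_r := conform_mx 0 (rowsub U V) in
  AU *m (invmx VU)^T *m V^T.

End Matrices.

Section RandomSubsets.
Context {d : measure_display} {Omega : measurableType d} {R : realType}.

Definition random_subset n (X : Omega -> {set 'I_n}) : Prop :=
  forall Y : {set 'I_n}, measurable [set w | X w = Y].

(* P(. | E), meaningful when P E != 0. *)
Definition cond_prob (P : probability Omega R) (E B : set Omega) : \bar R :=
  (P (B `&` E) * (fine (P E))^-1%:E)%E.

(* Under the probability mu, the random subset X follows DPP(K). No condition
   0 <= K <= I is imposed on the kernel: it only ensures that such a law
   exists. *)
Definition is_DPP n (mu : set Omega -> \bar R) (X : Omega -> {set 'I_n})
    (K : 'M[R]_n) : Prop :=
  forall Y : {set 'I_n},
    mu [set w | Y \subset X w] =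
    (\det (mxsub (@set_idx n Y) (@set_idx n Y) K))%:E.

End RandomSubsets.

(* Main.v *)
(* Put B = A - A V V^T, so B V = 0. The error of the oblique approximation is
   |B|^2 + |B(:,U) V(U,:)^-T|^2. For a single projection DPP with orthonormal V
   and B V = 0, Cramer's rule and Cauchy-Binet give
     E tr (B(:,S) K(S,S)^-1 B(:,S)^T) <= k |B|^2.
   Given S, rotating V by an orthogonal matrix such that V Q = [X, Y] with
   Y(S,:) = 0 and X(S,:) = L shows that the residual kernel is Y Y^T and that
   the error is the error for Y of B' = B - B(:,S) L^-T X^T. As B' Y = 0, the
   bound applied to T gives a factor 1 + p, while |B'|^2 equals
   |B|^2 + tr (B(:,S) K(S,S)^-1 B(:,S)^T). Since K(S,S) dominates
   V1(S,:) V1(S,:)^T, the same bound applied to S gives the factor 1 + k. *)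

Require Import Defs.
From mathcomp Require Import all_boot all_order all_fingroup all_algebra.
From mathcomp Require Import all_classical all_reals all_analysis.
From mathcomp Require Import measurable_realfun lra.

Set Implicit Arguments.
Unset Strict Implicit.
Unset Printing Implicit Defensive.

Import Order.TTheory GRing.Theory Num.Theory.

Local Open Scope ring_scope.

(** * Cauchy-Binet formula *)

Lemma det_mulmx_rect (R : comNzRingType) (k n : nat)
    (A : 'M[R]_(k, n)) (B : 'M[R]_(n, k)) :
  \det (A *m B) =
  \sum_(f : {ffun 'I_k -> 'I_n}) (\prod_i A i (f i)) * \det (rowsub f B).
Proof.
rewrite /determinant; under eq_bigr => s _.
  under eq_bigr do rewrite mxE.
  rewrite bigA_distr_bigA big_distrr; over.
rewrite exchange_big; apply: eq_bigr => /= f _; rewrite big_distrr.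
apply: eq_bigr => s _; rewrite big_split /= mulrCA; congr (_ * (_ * _)).
by apply: eq_bigr => i _; rewrite mxE.
Qed.

(** Expanding [\det (colsub f A)] over permutations [s] and replacing [f] by [f \o s] absorbs the
    sign, so every [s] contributes [\det (A *m B)]. Summing over all index lists instead of
    increasing ones produces the factor [k!]. *)
Lemma cauchy_binet (R : comNzRingType) (k n : nat)
    (A : 'M[R]_(k, n)) (B : 'M[R]_(n, k)) :
  \sum_(f : {ffun 'I_k -> 'I_n}) \det (colsub f A) * \det (rowsub f B) =
  k`!%:R * \det (A *m B).
Proof.
have cardS : #|'S_k| = k`! by rewrite card_Sn.
rewrite -cardS mulr_natl -sumr_const.
under eq_bigr do rewrite big_distrl /=.
rewrite exchange_big /=; apply: eq_big => // s _.
rewrite det_mulmx_rect.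
rewrite [RHS](reindex (fun f : {ffun _} => [ffun i => f (s i)])) /=; last first.
  exists (fun f : {ffun _} => [ffun i => f ((s^-1)%g i)]) => f _; apply/ffunP => i;
  by rewrite !ffunE ?permK ?permKV.
apply: eq_bigr => f _; rewrite -mulrA mulrCA; congr (_ * _).
  by apply: eq_bigr => i _; rewrite mxE ffunE.
have -> : rowsub [ffun i => f (s i)] B = row_perm s (rowsub f B).
  by apply/matrixP => i j; rewrite !mxE ffunE.
by rewrite row_permE det_mulmx det_perm.
Qed.

(** * Squared Frobenius norm *)

(** The trace form turns orthogonality and isometry arguments into matrix identities, without square
    roots. *)
Definition sqnorm (R : pzRingType) (m n : nat) (M : 'M[R]_(m, n)) : R :=
  \tr (M *m M^T).

Lemma sqnormE (R : pzRingType) (m n : nat) (M : 'M[R]_(m, n)) :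
  sqnorm M = \sum_i \sum_j M i j ^+ 2.
Proof.
apply: eq_bigr => i _; rewrite mxE; apply: eq_bigr => j _.
by rewrite mxE expr2.
Qed.

Lemma sqnorm_ge0 (R : realDomainType) (m n : nat) (M : 'M[R]_(m, n)) :
  0 <= sqnorm M.
Proof.
by rewrite sqnormE; apply: sumr_ge0 => i _; apply: sumr_ge0 => j _; exact: sqr_ge0.
Qed.

Lemma sqnorm_eq0 (R : realDomainType) (m n : nat) (M : 'M[R]_(m, n)) :
  sqnorm M = 0 -> M = 0.
Proof.
rewrite sqnormE => /psumr_eq0P M0; apply/matrixP => i j; rewrite mxE.
have {}M0 := M0 (fun i _ => sumr_ge0 _ (fun j _ => sqr_ge0 (M i j))) i isT.
by apply/eqP; rewrite -sqrf_eq0; apply/eqP/(psumr_eq0P _ M0) => // l _; exact: sqr_ge0.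
Qed.

Lemma sqnormD_orth (R : comPzRingType) (m n : nat) (M N : 'M[R]_(m, n)) :
  M *m N^T = 0 -> sqnorm (M + N) = sqnorm M + sqnorm N.
Proof.
move=> MN0; rewrite /sqnorm linearD /= mulmxDl !mulmxDr MN0.
have -> : N *m M^T = 0 by rewrite -[N]trmxK -trmx_mul MN0 trmx0.
by rewrite addr0 add0r raddfD.
Qed.

Lemma sqnormN (R : pzRingType) (m n : nat) (M : 'M[R]_(m, n)) :
  sqnorm (- M) = sqnorm M.
Proof. by rewrite /sqnorm linearN mulmxN mulNmx opprK. Qed.

Lemma sqnorm_row_mx (R : pzRingType) (m n1 n2 : nat)
    (M : 'M[R]_(m, n1)) (N : 'M[R]_(m, n2)) :
  sqnorm (row_mx M N) = sqnorm M + sqnorm N.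
Proof. by rewrite /sqnorm tr_row_mx mul_row_col raddfD. Qed.

Lemma sqnorm_mul_isometry (R : comPzRingType) (m n k : nat)
    (M : 'M[R]_(m, k)) (X : 'M[R]_(n, k)) :
  X^T *m X = 1%:M -> sqnorm (M *m X^T) = sqnorm M.
Proof. by move=> X1; rewrite /sqnorm trmx_mul trmxK mulmxA -(mulmxA M) X1 mulmx1. Qed.

(** * Energy bound for a single projection DPP *)

(** A set of size [k] is the image of exactly [k!] injections. This links the index lists of
    Cauchy-Binet to the subsets drawn by a DPP. *)
Lemma sum_inj_ffun (R : pzSemiRingType) (T : finType) (k : nat)
    (G : {set T} -> R) :
  \sum_(f : {ffun 'I_k -> T} | injectiveb f) G (f @: 'I_k) =
  k`!%:R * \sum_(s : {set T} | #|s| == k) G s.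
Proof.
have cardf (f : {ffun 'I_k -> T}) : injectiveb f -> #|f @: 'I_k| == k.
  by move=> /injectiveP fI; rewrite card_imset ?card_ord.
rewrite (partition_big (fun f : {ffun 'I_k -> T} => f @: 'I_k)
          (fun s : {set T} => #|s| == k)) //=.
rewrite mulr_sumr; apply: eq_bigr => s /eqP sk.
rewrite (eq_bigr (fun=> G s)) => [|f /andP[_ /eqP->] //].
rewrite sumr_const mulr_natl; congr (_ *+ _).
rewrite -ffactnn -[X in X ^_ _]sk -[X in _ ^_ X]card_ord.
rewrite -card_inj_ffuns_on -sum1dep_card -sum1_card.
apply: eq_bigl => f; rewrite unfold_in /= andbC; apply: andb_id2r => fI.
apply/eqP/ffun_onP => [<- i|fs]; first exact: imset_f.
apply/eqP; rewrite eqEcard sk (eqP (cardf _ fI)) leqnn andbT.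
by apply/fintype.subsetP => _ /imsetP[i _ ->]; exact: fs.
Qed.

(** For [K = V V^T] with [V(f,:)] square and invertible this is [|B(:,f) V(f,:)^-T|^2], the part of
    the oblique error added to [|B|^2]. *)
Definition gram_energy (R : comUnitRingType) (m n k : nat) (B : 'M[R]_(m, n))
    (K : 'M[R]_n) (f : 'I_k -> 'I_n) : R :=
  \tr (colsub f B *m invmx (mxsub f f K) *m (colsub f B)^T).

Lemma trmx_rowsub (R : Type) (m n k : nat) (f : 'I_k -> 'I_m) (A : 'M[R]_(m, n)) :
  (rowsub f A)^T = colsub f A^T.
Proof. by apply/matrixP => i j; rewrite !mxE. Qed.

Lemma mxsub_gram (R : pzSemiRingType) (n k q : nat) (f : 'I_q -> 'I_n)
    (V : 'M[R]_(n, k)) :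
  mxsub f f (V *m V^T) = rowsub f V *m (rowsub f V)^T.
Proof. by rewrite mxsub_mul trmx_rowsub. Qed.


Lemma invmx_uniq (R : comUnitRingType) (n : nat) (M N : 'M[R]_n) :
  M *m N = 1%:M -> invmx M = N.
Proof.
move=> MN; have [uM _] := mulmx1_unit MN.
by rewrite -[RHS](mulKmx uM) MN mulmx1.
Qed.

Lemma invmxM (R : comUnitRingType) (n : nat) (M N : 'M[R]_n) :
  M \in unitmx -> N \in unitmx -> invmx (M *m N) = invmx N *m invmx M.
Proof.
by move=> uM uN; apply: invmx_uniq; rewrite -mulmxA (mulKVmx uN) (mulmxV uM).
Qed.

(** Two injective lists of the same set differ by a permutation matrix, which cancels in both
    factors. The determinant in front disposes of the singular case. *)
Lemma gram_energy_reindex (F : fieldType) (m n k q : nat) (B : 'M[F]_(m, n))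
    (K : 'M[F]_n) (f : 'I_k -> 'I_n) (g : 'I_q -> 'I_n) :
  injective f -> injective g -> f @: 'I_k = g @: 'I_q ->
  \det (mxsub f f K) * gram_energy B K f = \det (mxsub g g K) * gram_energy B K g.
Proof.
move=> fI gI fg.
have kq : k = q by rewrite -[k]card_ord -[q]card_ord -(card_imset _ fI) fg card_imset.
case: q / kq in g gI fg *.
have /fin_all_exists[s sP] i : exists j, g i = f j.
  have : g i \in f @: 'I_k by rewrite fg imset_f.
  by case/imsetP => j _ ->; exists j.
have sI : injective s by move=> i j sij; apply: gI; rewrite !sP sij.
pose P : 'M[F]_k := perm_mx (perm sI).
have PtP : P^T *m P = 1%:M by rewrite tr_perm_mx -perm_mxM mulVg perm_mx1.
have uP : P \in unitmx by exact: unitmx_perm.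
have gK : mxsub g g K = P *m mxsub f f K *m P^T.
  rewrite tr_perm_mx -row_permE -col_permE.
  by apply/matrixP => i j; rewrite !mxE !permE !sP.
have gB : colsub g B = colsub f B *m P^T.
  by rewrite tr_perm_mx -col_permE; apply/matrixP => i j; rewrite !mxE !permE !sP.
have detP : \det P * \det P = 1.
  by rewrite -[X in _ * X]det_tr mulrC -det_mulmx PtP det1.
have detg : \det (mxsub g g K) = \det (mxsub f f K).
  by rewrite gK !det_mulmx det_tr mulrAC detP mul1r.
rewrite detg; case: (eqVneq (\det (mxsub f f K)) 0) => [->|nz]; first by rewrite !mul0r.
have uK : mxsub f f K \in unitmx by rewrite unitmxE unitfE.
rewrite /gram_energy gK gB !invmxM ?unitmx_mul ?uP ?unitmx_tr //.
rewrite trmx_mul trmxK; congr (_ * \tr _).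
by rewrite !mulmxA mulmxK ?unitmx_tr // mulmxKV.
Qed.

(* Cramer's rule turns the adjugate entries into determinants of the matrices
   obtained from [V] by replacing one column with a row of [B]; these have
   orthogonal columns, so Cauchy-Binet evaluates the sum of their squares. *)
Lemma sum_sqnorm_adj (R : comNzRingType) (m n k : nat) (B : 'M[R]_(m, n))
    (V : 'M[R]_(n, k)) :
  V^T *m V = 1%:M -> B *m V = 0 ->
  \sum_(f : {ffun 'I_k -> 'I_n})
    sqnorm (colsub f B *m (\adj (rowsub f V))^T) = k`!%:R * (k%:R * sqnorm B).
Proof.
move=> VV BV.
pose W a j : 'M[R]_(n, k) := \matrix_(i, l) if l == j then B a i else V i l.
have cramer (f : {ffun 'I_k -> 'I_n}) a j :
    (colsub f B *m (\adj (rowsub f V))^T) a j = \det (rowsub f (W a j)).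
  rewrite (expand_det_col _ j) mxE; apply: eq_bigr => i _.
  rewrite !mxE eqxx; congr (_ * (_ * \det _)).
  (* The cofactors delete column [j], the only one where [W a j] and [V] differ. *)
  by apply/matrixP => x y; rewrite !mxE eq_sym (negPf (neq_lift _ _)).
have detW a j : \det ((W a j)^T *m W a j) = \sum_i B a i ^+ 2.
  have -> : (W a j)^T *m W a j =
      diag_mx (\row_l if l == j then \sum_i B a i ^+ 2 else 1).
    apply/matrixP => x y; rewrite !mxE.
    under eq_bigr do rewrite !mxE.
    have BV0 l : \sum_i B a i * V i l = 0.
      by move/matrixP: BV => /(_ a l); rewrite !mxE.
    have [xj|xj] := eqVneq x j; have [yj|yj] := eqVneq y j.
    - by rewrite xj yj eqxx; apply: eq_bigr => i _; rewrite expr2.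
    - by rewrite xj eq_sym (negPf yj).
    - rewrite yj (negPf xj) -[RHS](BV0 x).
      by apply: eq_bigr => i _; rewrite mulrC.
    - move/matrixP: VV => /(_ x y); rewrite !mxE => <-.
      by apply: eq_bigr => i _; rewrite !mxE.
  rewrite det_diag (bigD1 j) //= [X in _ * X]big1 ?mulr1 ?mxE ?eqxx // => l lj.
  by rewrite mxE (negPf lj).
under eq_bigr do rewrite sqnormE.
rewrite exchange_big /= sqnormE !mulr_sumr; apply: eq_bigr => a _.
rewrite exchange_big /=.
(* Every replaced column [j] gives the same value, whence the factor [k]. *)
transitivity (\sum_(j < k) k`!%:R * \sum_i B a i ^+ 2); last first.
  by rewrite sumr_const card_ord !mulr_natl mulrnAC.
apply: eq_bigr => j _; rewrite -(detW a j) -cauchy_binet.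
by apply: eq_bigr => f _; rewrite cramer expr2 -trmx_rowsub det_tr.
Qed.

(* Equality unless [rowsub f V] is singular, in which case [invmx] is junk. *)
Lemma det_gram_energy_le (R : realFieldType) (m n k : nat) (B : 'M[R]_(m, n))
    (V : 'M[R]_(n, k)) (f : 'I_k -> 'I_n) :
  \det (mxsub f f (V *m V^T)) * gram_energy B (V *m V^T) f
  <= sqnorm (colsub f B *m (\adj (rowsub f V))^T).
Proof.
rewrite /gram_energy mxsub_gram; set N := rowsub f V.
rewrite det_mulmx det_tr; case: (eqVneq (\det N) 0) => [->|nz].
  by rewrite !mul0r sqnorm_ge0.
have uN : N \in unitmx by rewrite unitmxE unitfE.
rewrite invmxM ?unitmx_tr // -trmx_inv /sqnorm trmx_mul trmxK.
have -> : \adj N = \det N *: invmx N.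
  by rewrite -[LHS](mulmxK uN) mul_adj_mx mul_scalar_mx.
by rewrite linearZ /= -scalemxAl -!scalemxAr -scalemxAl !mxtraceZ !mulmxA mulrA.
Qed.

(** After multiplication by [k!] the left side is a sum over injective lists. It is bounded termwise
    by the adjugate sum over all lists, whose remaining terms are squares. *)
Lemma sum_det_gram_energy_le (R : realFieldType) (m n k : nat) (B : 'M[R]_(m, n))
    (V : 'M[R]_(n, k)) :
  V^T *m V = 1%:M -> B *m V = 0 ->
  \sum_(s : {set 'I_n} | #|s| == k)
     \det (mxsub (@set_idx n s) (@set_idx n s) (V *m V^T)) *
     gram_energy B (V *m V^T) (@set_idx n s) <= k%:R * sqnorm B.
Proof.
move=> VV BV; set K := V *m V^T.
pose G s := \det (mxsub (@set_idx n s) (@set_idx n s) K) * gram_energy B K (@set_idx n s).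
have kf0 : 0 < k`!%:R :> R by rewrite ltr0n fact_gt0.
rewrite -(ler_pM2l kf0) -(sum_sqnorm_adj VV BV) -(sum_inj_ffun _ G) big_mkcond /=.
apply: ler_sum => f _; case: ifP => [/injectiveP fI|_]; last exact: sqnorm_ge0.
apply: le_trans (det_gram_energy_le _ _ _).
rewrite le_eqVlt; apply/orP; left; apply/eqP.
apply: gram_energy_reindex => //; first exact: enum_val_inj.
apply/setP => i; apply/imsetP/idP => [[j _ ->]|i_f]; first exact: enum_valP.
by exists (enum_rank_in i_f i); rewrite // /set_idx enum_rankK_in.
Qed.

(** * Orthogonal reduction and comparison of Gram matrices *)

(** Induction on [p]: a normalised kernel vector is appended to [M] as a new row, which forces the
    later vectors to be orthogonal to it. *)
Lemma orthonormal_kernel (R : rcfType) (k p r : nat) (M : 'M[R]_(k, r)) :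
  (k + p <= r)%N ->
  exists Q : 'M[R]_(r, p), M *m Q = 0 /\ Q^T *m Q = 1%:M.
Proof.
elim: p k M => [|p IH] k M kpr.
  by exists 0; rewrite mulmx0; split=> //; apply/matrixP => - [[]].
have ker0 : kermx M^T != 0.
  rewrite kermx_eq0 -row_leq_rank mxrank_tr -ltnNge.
  apply: leq_ltn_trans (rank_leq_row M) _; rewrite (leq_trans _ kpr) //.
  by rewrite addnS ltnS leq_addr.
pose v := nz_row (kermx M^T).
have v0 : v != 0 by rewrite nz_row_eq0.
have Mv : M *m v^T = 0.
  by apply: trmx_inj; rewrite trmx_mul trmxK trmx0; apply/sub_kermxP/nz_row_sub.
have nv : 0 < sqnorm v.
  rewrite lt_def sqnorm_ge0 andbT; apply: contraNneq v0 => /sqnorm_eq0 ->.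
  exact: eqxx.
pose u : 'rV[R]_r := (Num.sqrt (sqnorm v))^-1 *: v.
have uu : u *m u^T = 1%:M.
  rewrite [u *m _]mx11_scalar; congr _%:M.
  rewrite linearZ /= -scalemxAl -scalemxAr scalerA !mxE.
  have -> : \sum_j v 0 j * v^T j 0 = sqnorm v by rewrite /sqnorm /mxtrace big_ord1 mxE.
  by rewrite -expr2 exprVn sqr_sqrtr ?ltW // mulVf ?gt_eqF.
have [|Q [MQ QQ]] := IH _ (col_mx M u); first by rewrite addn1 addSnnS.
have /eq_col_mx[{}MQ uQ] : col_mx (M *m Q) (u *m Q) = col_mx 0 0.
  by rewrite -mul_col_mx MQ col_mx0.
(* Writing the width as [1 + p] lets [row_mx] build the witness. *)
suff: exists P : 'M[R]_(r, 1 + p), M *m P = 0 /\ P^T *m P = 1%:M by [].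
exists (row_mx u^T Q); split.
  by rewrite mul_mx_row MQ linearZ /= -scalemxAr Mv scaler0 row_mx0.
have Qu : Q^T *m u^T = 0 by rewrite -trmx_mul uQ trmx0.
by rewrite tr_row_mx trmxK mul_col_row scalar_mx_block; congr block_mx.
Qed.

(** A block LQ factorisation: the last [p] columns of [Q] are orthonormal in the kernel of [M], and
    the first [k] complete them. *)
Lemma orthogonal_lower (R : rcfType) (k p : nat) (M : 'M[R]_(k, k + p)) :
  exists (Q : 'M[R]_(k + p)) (L : 'M[R]_k),
    Q^T *m Q = 1%:M /\ M *m Q = row_mx L 0.
Proof.
have [Q2 [MQ2 Q22]] := @orthonormal_kernel R k p _ M (leqnn _).
have [|Q1 [Q21 Q11]] := @orthonormal_kernel R p k _ Q2^T; first by rewrite addnC.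
exists (row_mx Q1 Q2), (M *m Q1); split; last by rewrite mul_mx_row; congr row_mx.
have Q12 : Q1^T *m Q2 = 0 by rewrite -[LHS]trmxK trmx_mul trmxK Q21 trmx0.
by rewrite tr_row_mx mul_col_row scalar_mx_block; congr block_mx.
Qed.

(** A row vector that kills [L] has [|u N|^2 + |u F|^2 = 0], so it also kills [N]. *)
Lemma unitmx_factor_dominated (R : realFieldType) (k p : nat) (L N : 'M[R]_k)
    (F : 'M[R]_(k, p)) :
  L *m L^T = N *m N^T + F *m F^T -> N \in unitmx -> L \in unitmx.
Proof.
move=> LNF uN; rewrite -row_free_unit; apply: inj_row_free => u uL.
have : sqnorm (u *m N) + sqnorm (u *m F) = 0.
  rewrite /sqnorm -mxtraceD !trmx_mul !mulmxA -mulmxDl -!mulmxA -mulmxDr -LNF.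
  by rewrite !mulmxA uL !mul0mx mxtrace0.
move/eqP; rewrite paddr_eq0 ?sqnorm_ge0 // => /andP[/eqP/sqnorm_eq0 uN0 _].
by rewrite -[u](mulmxK uN) uN0 mul0mx.
Qed.

(** Inversion reverses the order of positive definite matrices. With [y = C L^-T = u L] and
    [c = C N^-T], one has [<c, u N> = |y|^2] and [|u N| <= |y|]; expanding [|c - u N|^2 >= 0] then
    gives [|y| <= |c|]. *)
Lemma sqnorm_solve_antitone (R : realFieldType) (m k p : nat) (L N : 'M[R]_k)
    (F : 'M[R]_(k, p)) (C : 'M[R]_(m, k)) :
  L *m L^T = N *m N^T + F *m F^T -> N \in unitmx ->
  sqnorm (C *m (invmx L)^T) <= sqnorm (C *m (invmx N)^T).
Proof.
move=> LNF uN; have uL := unitmx_factor_dominated LNF uN.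
have : C *m (invmx L)^T *m L^T = C *m (invmx N)^T *m N^T.
  by rewrite -!mulmxA -!trmx_mul !mulmxV // trmx1.
move: (C *m _) (C *m _) => c y yc.
have [u uLy] : exists u, u *m L = y by exists (y *m invmx L); rewrite mulmxKV.
have ycu : sqnorm y = \tr (c *m (u *m N)^T).
  by rewrite /sqnorm -{2}uLy !trmx_mul !mulmxA yc.
have uNy : sqnorm (u *m N) <= sqnorm y.
  rewrite -uLy /sqnorm !trmx_mul !mulmxA -[u *m L *m _]mulmxA LNF mulmxDr mulmxDl.
  rewrite mxtraceD /= !mulmxA lerDl -[X in \tr X]mulmxA -trmx_mul.
  exact: sqnorm_ge0.
have cuy : \tr (u *m N *m c^T) = sqnorm y.
  by rewrite ycu -mxtrace_tr trmx_mul trmxK.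
have : sqnorm (c - u *m N) = sqnorm c - sqnorm y - (sqnorm y - sqnorm (u *m N)).
  by rewrite {1}/sqnorm linearB /= mulmxBl !mulmxBr !raddfB /= cuy -ycu.
have := sqnorm_ge0 (c - u *m N).
move: uNy; lra.
Qed.

Lemma gram_energyE (R : comUnitRingType) (m n k : nat) (B : 'M[R]_(m, n))
    (K : 'M[R]_n) (N : 'M[R]_k) (f : 'I_k -> 'I_n) :
  mxsub f f K = N *m N^T -> N \in unitmx ->
  gram_energy B K f = sqnorm (colsub f B *m (invmx N)^T).
Proof.
move=> KN uN; rewrite /gram_energy KN invmxM ?unitmx_tr //.
by rewrite /sqnorm trmx_mul trmxK trmx_inv !mulmxA.
Qed.

(** * Oblique error given the first sample *)

Lemma residual_orth (R : pzRingType) (m n r : nat) (A : 'M[R]_(m, n))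
    (V : 'M[R]_(n, r)) :
  V^T *m V = 1%:M -> (A - A *m V *m V^T) *m V = 0.
Proof. by move=> VV; rewrite mulmxBl -mulmxA VV mulmx1 subrr. Qed.

(** The oblique approximation reproduces [A V V^T] exactly, so only [B] contributes to the error;
    Pythagoras applies because [B V = 0]. *)
Lemma sqnorm_oblique_error (R : realType) (m n r : nat) (A : 'M[R]_(m, n))
    (V : 'M[R]_(n, r)) (U : 'I_r -> 'I_n) (B := A - A *m V *m V^T) :
  V^T *m V = 1%:M -> rowsub U V \in unitmx ->
  sqnorm (A - oblique_approx A V U) =
  sqnorm B + sqnorm (colsub U B *m (invmx (rowsub U V))^T).
Proof.
move=> VV uU; rewrite /oblique_approx !conform_mx_id; set W := (invmx _)^T.
have BV : B *m V = 0 by exact: residual_orth.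
have -> : A - colsub U A *m W *m V^T = B - colsub U B *m W *m V^T.
  have -> : colsub U B = colsub U A - A *m V *m colsub U V^T.
    by rewrite mulmx_colsub; apply/matrixP => i j; rewrite !mxE.
  rewrite !mulmxBl opprB -[A *m V *m _ *m W]mulmxA.
  have -> : colsub U V^T *m W = 1%:M.
    by rewrite -trmx_rowsub -trmx_mul mulVmx // trmx1.
  by rewrite mulmx1 addrA subrK.
rewrite sqnormD_orth ?sqnormN ?(sqnorm_mul_isometry _ VV) //.
by rewrite linearN /= trmx_mul trmxK mulmxN mulmxA BV mul0mx oppr0.
Qed.

Lemma rowsub_cat_idx (T : Type) (n r q1 q2 : nat) (V : 'M[T]_(n, r))
    (f : 'I_q1 -> 'I_n) (g : 'I_q2 -> 'I_n) :
  rowsub (cat_idx f g) V = col_mx (rowsub f V) (rowsub g V).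
Proof.
by apply/matrixP => i j; rewrite !mxE /cat_idx; case: splitP => l _; rewrite mxE.
Qed.

Lemma colsub_cat_idx (T : Type) (n r q1 q2 : nat) (V : 'M[T]_(r, n))
    (f : 'I_q1 -> 'I_n) (g : 'I_q2 -> 'I_n) :
  colsub (cat_idx f g) V = row_mx (colsub f V) (colsub g V).
Proof.
by apply/matrixP => i j; rewrite !mxE /cat_idx; case: splitP => l _; rewrite mxE.
Qed.

(** Given [s], the problem becomes that of a single projection DPP, with [Y] and [B'] in place of
    [V] and [B]. Giving [V1] the width [#|s|] makes [V1(s,:)] square. *)
Lemma conditional_error (R : realType) (m n p : nat) (s : {set 'I_n})
    (A : 'M[R]_(m, n)) (V1 : 'M[R]_(n, #|s|)) (V2 : 'M[R]_(n, p))
    (V := row_mx V1 V2) (K := V *m V^T) (B := A - A *m V *m V^T) :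
  V^T *m V = 1%:M ->
  \det (mxsub (@set_idx n s) (@set_idx n s) (V1 *m V1^T)) != 0 ->
  exists (Y : 'M[R]_(n, p)) (B' : 'M[R]_(m, n)),
  [/\ Y^T *m Y = 1%:M, residual_kernel K s = Y *m Y^T, B' *m Y = 0,
      sqnorm B' <= sqnorm B + gram_energy B (V1 *m V1^T) (@set_idx n s) &
      forall t : {set 'I_n}, #|t| = p ->
        \det (mxsub (@set_idx n t) (@set_idx n t) (Y *m Y^T)) != 0 ->
        sqnorm (A - oblique_approx A V (cat_idx (@set_idx n s) (@set_idx n t)))
        = sqnorm B' + gram_energy B' (Y *m Y^T) (@set_idx n t)].
Proof.
move=> VV; set f := @set_idx n s => dets.
have BV : B *m V = 0 by exact: residual_orth.
have [Q [L [QQ fQ]]] := orthogonal_lower (rowsub f V).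
have QQt : Q *m Q^T = 1%:M by exact: mulmx1C.
set X := lsubmx (V *m Q); set Y := rsubmx (V *m Q).
have VQ : V *m Q = row_mx X Y by rewrite hsubmxK.
have : (V *m Q)^T *m (V *m Q) = 1%:M.
  by rewrite trmx_mul mulmxA -(mulmxA Q^T) VV mulmx1.
rewrite VQ tr_row_mx mul_col_row (@scalar_mx_block _ #|s| p) => /eq_block_mx[XX XY YX YY].
have [BX BY] : B *m X = 0 /\ B *m Y = 0.
  have := congr1 (mulmx^~ Q) BV; rewrite -mulmxA VQ mul0mx mul_mx_row -[RHS]hsubmxK.
  by move=> /eq_row_mx[-> ->]; rewrite !linear0.
have [fX fY] : rowsub f X = L /\ rowsub f Y = 0.
  move: fQ; rewrite mul_rowsub_mx VQ => fXY; apply: eq_row_mx.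
  by rewrite -fXY; apply/matrixP => i j; rewrite !mxE; case: splitP => l _; rewrite mxE.
have KE : K = X *m X^T + Y *m Y^T.
  transitivity ((V *m Q) *m (V *m Q)^T).
    by rewrite trmx_mul mulmxA -(mulmxA V) QQt mulmx1.
  by rewrite VQ tr_row_mx mul_row_col.
have Kff : mxsub f f K = L *m L^T.
  by rewrite KE raddfD /= !mxsub_gram fX fY mul0mx addr0.
have KV12 : mxsub f f K = rowsub f V1 *m (rowsub f V1)^T + rowsub f V2 *m (rowsub f V2)^T.
  by rewrite /K /V tr_row_mx mul_row_col raddfD /= !mxsub_gram.
have uV1 : rowsub f V1 \in unitmx.
  rewrite unitmxE unitfE; apply: contraNneq dets => V10.
  by rewrite mxsub_gram det_mulmx V10 mul0r.
have LV12 := etrans (esym Kff) KV12.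
have uL := unitmx_factor_dominated LV12 uV1.
pose C1 := colsub f B *m (invmx L)^T.
(* As [X(s,:) = L], this correction clears the columns [s] of [B]. *)
pose B' := B - C1 *m X^T.
have sqB' : sqnorm B' = sqnorm B + sqnorm C1.
  rewrite sqnormD_orth ?sqnormN ?(sqnorm_mul_isometry _ XX) //.
  by rewrite linearN /= trmx_mul trmxK mulmxN mulmxA BX mul0mx oppr0.
exists Y, B'; split=> //.
- rewrite /residual_kernel -/f Kff invmxM ?unitmx_tr // KE.
  have -> : rowsub f (X *m X^T + Y *m Y^T) = L *m X^T.
    by rewrite raddfD /= -!mul_rowsub_mx fX fY mul0mx addr0.
  have -> : colsub f (X *m X^T + Y *m Y^T) = X *m L^T.
    by rewrite raddfD /= -!mulmx_colsub -!trmx_rowsub fX fY trmx0 mulmx0 addr0.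
  by rewrite !mulmxA mulmxK ?unitmx_tr // mulmxKV // addrAC subrr add0r.
- by rewrite mulmxBl BY -mulmxA XY mulmx0 subrr.
- rewrite sqB' lerD2l (gram_energyE B (mxsub_gram f V1) uV1).
  exact: sqnorm_solve_antitone LV12 uV1.
move=> t tp; subst p; set g := @set_idx n t => dett.
have uY : rowsub g Y \in unitmx.
  rewrite unitmxE unitfE; apply: contraNneq dett => Y0.
  by rewrite mxsub_gram det_mulmx Y0 mul0r.
set U := cat_idx f g.
(* The rotated [V(U,:)] is block triangular, so it is invertible as soon as [L] and [Y(t,:)] are. *)
have UVQ : rowsub U V *m Q = block_mx L 0 (rowsub g X) (rowsub g Y).
  rewrite mul_rowsub_mx VQ rowsub_cat_idx -fX -fY.
  apply/matrixP => i j; rewrite !mxE.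
  by case: splitP => a _; rewrite !mxE; case: splitP => b _; rewrite !mxE.
have uUQ : rowsub U V *m Q \in unitmx.
  by rewrite UVQ unitmxE det_lblock unitrM -!unitmxE uL uY.
have uU : rowsub U V \in unitmx by move: uUQ; rewrite unitmx_mul => /andP[].
rewrite sqnorm_oblique_error // sqB' -addrA; congr (_ + _).
rewrite (gram_energyE B' (mxsub_gram g Y) uY).
set C2 := colsub g B' *m _.
(* Forward substitution: [C1] solves the block of [s], and [C2] the block of [t] once the
   contribution of [C1] is removed. *)
have CE : colsub U B = row_mx C1 C2 *m (rowsub U V *m Q)^T.
  rewrite UVQ tr_block_mx trmx0 mul_row_block mulmx0 addr0 /C1 /C2 colsub_cat_idx.
  rewrite -!mulmxA -!trmx_mul !mulmxV // !trmx1 !mulmx1; congr row_mx.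
  rewrite trmx_mul mulmxA -/C1 trmx_rowsub mulmx_colsub -raddfD /=.
  by rewrite addrC subrK.
have -> : colsub U B *m (invmx (rowsub U V))^T = row_mx C1 C2 *m Q^T.
  by rewrite CE -mulmxA -trmx_mul mulKmx.
by rewrite sqnorm_mul_isometry // sqnorm_row_mx.
Qed.

(** * Weights of a projection DPP *)

(** The size is a variable because the cardinal of a set equals 0 only propositionally. *)
Lemma det_size0 (R : comPzRingType) (n : nat) (M : 'M[R]_n) : n = 0%N -> \det M = 1.
Proof. by move=> n0; subst n; rewrite det_mx00. Qed.

Lemma det_size1 (R : comPzRingType) (n : nat) (M : 'M[R]_n) (i : 'I_n) :
  n = 1%N -> \det M = M i i.
Proof. by move=> n1; subst n; rewrite {1}[M]mx11_scalar det_scalar1 !ord1. Qed.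

Lemma det_gram_gt_rank (F : fieldType) (n k : nat) (N : 'M[F]_(n, k)) :
  (k < n)%N -> \det (N *m N^T) = 0.
Proof.
move=> kn; apply/eqP; apply: contraLR kn; rewrite -unitfE -unitmxE -row_free_unit -leqNgt.
move=> /eqP <-; exact: mulmx_max_rank.
Qed.

Lemma dpp_total_weight (R : comPzRingType) (n : nat) (K : 'M[R]_n)
    (q : {set 'I_n} -> R) :
  (forall Y : {set 'I_n}, \sum_(x : {set 'I_n} | Y \subset x) q x =
     \det (mxsub (@set_idx n Y) (@set_idx n Y) K)) ->
  \sum_x q x = 1.
Proof.
move=> qdet.
rewrite -[RHS](det_size0 (mxsub (@set_idx n _) (@set_idx n _) K) (cards0 _)) -qdet.
by apply: eq_bigl => x; rewrite finset.sub0set.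
Qed.

(* The mean size of [X] is the trace [k] of the kernel while larger sizes have
   weight zero because the kernel has rank [k], hence all the mass sits on
   sets of size exactly [k]. *)
Lemma projection_dpp_weight (R : realFieldType) (n k : nat) (V : 'M[R]_(n, k))
    (q : {set 'I_n} -> R) :
  V^T *m V = 1%:M -> (forall x, 0 <= q x) ->
  (forall Y : {set 'I_n}, \sum_(x : {set 'I_n} | Y \subset x) q x =
     \det (mxsub (@set_idx n Y) (@set_idx n Y) (V *m V^T))) ->
  forall x : {set 'I_n}, q x = if #|x| == k
    then \det (mxsub (@set_idx n x) (@set_idx n x) (V *m V^T)) else 0.
Proof.
move=> VV q0 qdet.
have big0 (x : {set 'I_n}) : (k < #|x|)%N -> q x = 0.
  move=> kx; have := qdet x; rewrite mxsub_gram det_gram_gt_rank // => /psumr_eq0P.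
  by apply.
have total : \sum_x q x = 1 by exact: dpp_total_weight qdet.
have mean : \sum_x q x * #|x|%:R = k%:R.
  transitivity (\sum_(x : {set 'I_n}) \sum_(i in x) q x).
    by apply: eq_bigr => x _; rewrite sumr_const mulr_natr.
  rewrite (exchange_big_dep predT) //=.
  (* [k = tr (V^T V) = tr (V V^T)], and the diagonal entry at [i] is the total weight of the sets
     containing [i]. *)
  rewrite -(mxtrace1 _ k) -VV mxtrace_mulC; apply: eq_bigr => i _.
  transitivity (\sum_(x : {set 'I_n} | [set i] \subset x) q x).
    by apply: eq_bigl => x; rewrite finset.sub1set.
  rewrite qdet.
  have i1 : i \in [set i] by rewrite inE.
  rewrite (det_size1 _ (enum_rank_in i1 i)) ?cards1 // [LHS]mxE.
  by rewrite /set_idx enum_rankK_in.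
have small0 (x : {set 'I_n}) : (#|x| < k)%N -> q x = 0.
  (* These nonnegative terms add up to [k - k = 0], so each of them vanishes. *)
  have term0 (y : {set 'I_n}) : true -> 0 <= q y * (k%:R - #|y|%:R).
    move=> _; have [ky|ky] := ltnP k #|y|; first by rewrite big0 ?mul0r.
    by rewrite mulr_ge0 ?q0 // subr_ge0 ler_nat.
  have : \sum_y q y * (k%:R - #|y|%:R) = 0.
    under eq_bigr do rewrite mulrBr.
    by rewrite sumrB mean -mulr_suml total mul1r subrr.
  move=> /(psumr_eq0P term0) /(_ x isT) /eqP; rewrite mulf_eq0 subr_eq0 eqr_nat.
  by move=> /orP[/eqP//|/eqP <-]; rewrite ltnn.
move=> x; case: ltngtP => [/small0//|/big0//|xk].
(* Among the supersets of [x] only [x] keeps its weight: the proper ones have more than [k]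
   elements. *)
rewrite -qdet (bigD1 x) //= big1 ?addr0 // => y /andP[xy yx].
apply: big0; rewrite -xk; apply: proper_card.
by rewrite finset.properEneq eq_sym yx.
Qed.

(** * Mean errors for finite weights *)

Lemma conditional_mean_error_le (R : realType) (m n k p : nat) (s : {set 'I_n})
    (A : 'M[R]_(m, n)) (V1 : 'M[R]_(n, k)) (V2 : 'M[R]_(n, p))
    (q : {set 'I_n} -> R)
    (V := row_mx V1 V2) (K := V *m V^T) (B := A - A *m V *m V^T) :
  V^T *m V = 1%:M -> #|s| = k ->
  \det (mxsub (@set_idx n s) (@set_idx n s) (V1 *m V1^T)) != 0 ->
  (forall t, 0 <= q t) ->
  (forall Y : {set 'I_n}, \sum_(t : {set 'I_n} | Y \subset t) q t =
     \det (mxsub (@set_idx n Y) (@set_idx n Y) (residual_kernel K s))) ->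
  \sum_t q t *
    sqnorm (A - oblique_approx A V (cat_idx (@set_idx n s) (@set_idx n t)))
  <= (1 + p%:R) * (sqnorm B + gram_energy B (V1 *m V1^T) (@set_idx n s)).
Proof.
move=> VV sk dets q0 qdet; subst k.
have [Y [B' [YY KY BY sqB' err]]] := conditional_error A VV dets.
rewrite KY in qdet.
have total : \sum_t q t = 1 by exact: dpp_total_weight qdet.
have qE := projection_dpp_weight YY q0 qdet.
apply: (@le_trans _ _ ((1 + p%:R) * sqnorm B')); last first.
  by rewrite ler_wpM2l // addr_ge0.
have -> : (1 + p%:R) * sqnorm B' = \sum_t q t * sqnorm B' + p%:R * sqnorm B'.
  by rewrite -mulr_suml total mulrDl.
have -> : \sum_t q t *
    sqnorm (A - oblique_approx A V (cat_idx (@set_idx n s) (@set_idx n t)))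
  = \sum_t q t * sqnorm B' + \sum_(t : {set 'I_n} | #|t| == p)
     \det (mxsub (@set_idx n t) (@set_idx n t) (Y *m Y^T)) *
     gram_energy B' (Y *m Y^T) (@set_idx n t).
  rewrite [X in _ + X]big_mkcond -big_split /=; apply: eq_bigr => t _.
  (* Sets of size other than [p] and sets with singular minor have weight 0, so the default values
     of [oblique_approx] there do not count. *)
  rewrite qE; case: eqP => [tp|_]; last by rewrite !mul0r addr0.
  have [->|dett] := eqVneq (\det (mxsub (@set_idx n t) (@set_idx n t) (Y *m Y^T))) 0.
    by rewrite !mul0r addr0.
  by rewrite err // mulrDr.
by rewrite lerD2l; exact: sum_det_gram_energy_le.
Qed.

(** The energy bound is used twice: inside the conditional mean for the factor [1 + p], then over
    [s] for [1 + k]. The weights [qc s] follow the residual kernel only where [q s != 0], since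
    conditioning on a null event carries no information. *)
Lemma mean_error_le (R : realType) (m n k p : nat)
    (A : 'M[R]_(m, n)) (V1 : 'M[R]_(n, k)) (V2 : 'M[R]_(n, p))
    (q : {set 'I_n} -> R) (qc : {set 'I_n} -> {set 'I_n} -> R)
    (V := row_mx V1 V2) (K := V *m V^T) :
  V^T *m V = 1%:M ->
  (forall s, 0 <= q s) -> (forall s t, 0 <= qc s t) ->
  (forall Y : {set 'I_n}, \sum_(s : {set 'I_n} | Y \subset s) q s =
     \det (mxsub (@set_idx n Y) (@set_idx n Y) (V1 *m V1^T))) ->
  (forall s Y : {set 'I_n}, q s != 0 -> \sum_(t : {set 'I_n} | Y \subset t) qc s t =
     \det (mxsub (@set_idx n Y) (@set_idx n Y) (residual_kernel K s))) ->
  \sum_s q s * \sum_t qc s t *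
    sqnorm (A - oblique_approx A V (cat_idx (@set_idx n s) (@set_idx n t)))
  <= (1 + k%:R) * (1 + p%:R) * sqnorm (A - A *m V *m V^T).
Proof.
move=> VV q0 qc0 qdet qcdet; set B := A - _.
have V11 : V1^T *m V1 = 1%:M.
  by move: VV; rewrite tr_row_mx mul_col_row scalar_mx_block => /eq_block_mx[].
have BV1 : B *m V1 = 0.
  have := residual_orth A VV; rewrite mul_mx_row => /(congr1 lsubmx).
  by rewrite row_mxKl linear0.
have total : \sum_s q s = 1 by exact: dpp_total_weight qdet.
have qE := projection_dpp_weight V11 q0 qdet.
have step s : q s * \sum_t qc s t *
      sqnorm (A - oblique_approx A V (cat_idx (@set_idx n s) (@set_idx n t)))
    <= (1 + p%:R) * (q s * sqnorm B + if #|s| == k then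
     \det (mxsub (@set_idx n s) (@set_idx n s) (V1 *m V1^T)) *
      gram_energy B (V1 *m V1^T) (@set_idx n s) else 0).
  have := qE s; case: eqP => [sk qs|_ ->]; last by rewrite !mul0r addr0 mulr0.
  rewrite -qs; have [->|qs0] := eqVneq (q s) 0; first by rewrite !mul0r addr0 mulr0.
  rewrite -mulrDr mulrCA ler_wpM2l //.
  apply: (@conditional_mean_error_le _ _ _ _ _ s A V1 V2 (qc s)) => //.
    by rewrite -qs.
  by move=> Y; apply: qcdet.
apply: le_trans (ler_sum _ (fun s _ => step s)) _.
rewrite -mulr_sumr big_split /= -mulr_suml total mul1r -big_mkcond /=.
rewrite [(1 + k%:R) * _]mulrC -mulrA ler_wpM2l ?addr_ge0 // mulrDl mul1r lerD2l.
exact: sum_det_gram_energy_le.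
Qed.

(** * Finite-valued random variables and the expectation *)

Local Open Scope classical_set_scope.
Local Open Scope ring_scope.

(** The integrand is a finite nonnegative combination of indicators of level sets of [X]. *)
Lemma ge0_integral_finType {R : realType} {d : measure_display}
    {Omega : measurableType d} (mu : {measure set Omega -> \bar R}) (I : finType)
    (X : Omega -> I) (D : set Omega) (f : I -> R) :
  (forall x, measurable [set w | X w = x]) -> measurable D ->
  (forall x, 0 <= f x) ->
  (\int[mu]_(w in D) (f (X w))%:E =
   \sum_(x : I) (f x)%:E * mu ([set w | X w = x] `&` D))%E.
Proof.
move=> mX mD f0.
transitivity (\int[mu]_(w in D)
    (\sum_(x <- index_enum I) (f x * \1_([set w' | X w' = x]) w)%:E))%E.
  apply: eq_integral => w _; rewrite sumEFin; congr EFin.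
  rewrite (bigD1 (X w)) //= indicE mem_set // mulr1 big1 ?addr0 // => x xX.
  rewrite indicE memNset ?mulr0 //= => Xx; move: xX.
  by rewrite Xx eqxx.
rewrite ge0_integral_sum //.
- apply: eq_bigr => x _.
  rewrite (integralZl_indic _ (fun=> [set w | X w = x])) //.
    by rewrite integral_indic.
  by move=> fx0; have := f0 x; rewrite leNgt fx0.
- move=> x; apply/measurable_EFinP; exact: measurable_funM.
- by move=> x w _; rewrite lee_fin mulr_ge0.
Qed.

(** Obtained by integrating the indicator of [C] over [D]. Taking [D] full or [D] the event [S = s]
    covers the plain and the conditional law. *)
Lemma measure_finType_partition {R : realType} {d : measure_display}
    {Omega : measurableType d} (mu : {measure set Omega -> \bar R}) (I : finType)
    (X : Omega -> I) (D : set Omega) (C : pred I) :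
  (forall x, measurable [set w | X w = x]) -> measurable D ->
  (mu ([set w | C (X w)] `&` D) =
   \sum_(x : I | C x) mu ([set w | X w = x] `&` D))%E.
Proof.
move=> mX mD.
have mC : measurable [set w | C (X w)].
  have -> : [set w | C (X w)] = \bigcup_(x in [set` C]) [set w | X w = x].
    by apply/seteqP; split=> [w Cw|w [x Cx /= Xx]]; [exists (X w)|rewrite /= Xx].
  by apply: fin_bigcup_measurable => // x _; exact: mX.
rewrite -integral_indic //.
transitivity (\int[mu]_(w in D) ((C (X w))%:R : R)%:E)%E.
  by apply: eq_integral => w _; rewrite indicE; congr (_%:R)%:E; rewrite mem_setE.
rewrite (@ge0_integral_finType _ _ _ mu _ _ _ (fun x => (C x)%:R) mX mD) // [RHS]big_mkcond.
by apply: eq_bigr => x _; case: (C x); rewrite ?mul1e ?mul0e.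
Qed.

Lemma frobenius_normE {R : realType} (m n : nat) (M : 'M[R]_(m, n)) :
  frobenius_norm M ^+ 2 = sqnorm M.
Proof. by rewrite /frobenius_norm -sqnormE sqr_sqrtr ?sqnorm_ge0. Qed.

Unset Implicit Arguments.

Theorem theorem3p3 (R : realType) (m n k p : nat)
    (A : 'M[R]_(m, n)) (V1 : 'M[R]_(n, k)) (V2 : 'M[R]_(n, p))
    (d : measure_display) (Omega : measurableType d)
    (P : probability Omega R) (S T : Omega -> {set 'I_n}) :
  let V := row_mx V1 V2 in
  let K := V *m V^T in
  V^T *m V = 1%:M ->
  random_subset S ->
  random_subset T ->
  is_DPP P S (V1 *m V1^T) ->
  (forall s : {set 'I_n}, P [set w | S w = s] != 0%E ->
     is_DPP (cond_prob P [set w | S w = s]) T (residual_kernel K s)) ->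
  let U (w : Omega) := cat_idx (@set_idx n (S w)) (@set_idx n (T w)) in
  ('E_P[fun w => (frobenius_norm (A - oblique_approx A V (U w)) ^+ 2)%R]
   <= ((1 + k%:R) * (1 + p%:R) * frobenius_norm (A - A *m V *m V^T) ^+ 2)%:E)%E.
Proof.
move=> V K VV mS mT dppS dppT; lazy zeta.
pose err (x : {set 'I_n} * {set 'I_n}) : R :=
  sqnorm (A - oblique_approx A V (cat_idx (@set_idx n x.1) (@set_idx n x.2))).
pose q s := fine (P [set w | S w = s]).
pose joint s t := P ([set w | T w = t] `&` [set w | S w = s]).
(* Where [q s = 0] the inverse is 0 and so is [qc s t]; the product formula for [joint] survives
   because [joint s t] is at most [q s]. *)
pose qc s t := fine (joint s t) * (q s)^-1.
have fin (E : set Omega) : measurable E -> P E \is a fin_num.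
  by move=> mE; exact: fin_num_measure.
have q0 s : 0 <= q s by exact/fine_ge0/measure_ge0.
have qc0 s t : 0 <= qc s t.
  by rewrite mulr_ge0 ?invr_ge0 ?q0 //; exact/fine_ge0/measure_ge0.
have mTS s t : measurable ([set w | T w = t] `&` [set w | S w = s]).
  by apply: measurableI; [exact: mT|exact: mS].
have jointE s t : (joint s t = (q s * qc s t)%:E)%E.
  have [qs0|qs0] := eqVneq (q s) 0.
    rewrite [in RHS]qs0 mul0r; apply/eqP; rewrite eq_le measure_ge0 andbT.
    by rewrite -qs0 fineK ?fin //; apply: le_measure; rewrite ?inE.
  by rewrite mulrC divfK // fineK // fin.
have qdet (Y : {set 'I_n}) : \sum_(s : {set 'I_n} | Y \subset s) q s =
    \det (mxsub (@set_idx n Y) (@set_idx n Y) (V1 *m V1^T)).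
  apply: EFin_inj; rewrite -(dppS Y) -sumEFin.
  have := measure_finType_partition P (fun s : {set 'I_n} => Y \subset s) mS measurableT.
  rewrite setIT => ->; apply: eq_bigr => s _.
  by rewrite setIT fineK ?fin.
have qcdet (s Y : {set 'I_n}) : q s != 0 -> \sum_(t : {set 'I_n} | Y \subset t) qc s t =
    \det (mxsub (@set_idx n Y) (@set_idx n Y) (residual_kernel K s)).
  move=> qs0; have Ps0 : P [set w | S w = s] != 0%E.
    by apply: contraNneq qs0 => Ps0; rewrite /q Ps0.
  apply: EFin_inj; rewrite -(dppT s Ps0 Y) /cond_prob.
  rewrite (measure_finType_partition P (fun t : {set 'I_n} => Y \subset t) mT (mS s)).
  rewrite (eq_bigr (fun t => (fine (joint s t))%:E)); last first.
    by move=> t _; rewrite fineK ?fin.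
  by rewrite sumEFin -EFinM mulr_suml.
have mST (x : {set 'I_n} * {set 'I_n}) : measurable [set w | (S w, T w) = x].
  have -> : [set w | (S w, T w) = x] = [set w | T w = x.2] `&` [set w | S w = x.1].
    by case: x => s t; apply/seteqP; split=> w /= [-> ->].
  exact: mTS.
rewrite unlock.
have -> : (\int[P]_w (frobenius_norm (A - oblique_approx A V
      (cat_idx (@set_idx n (S w)) (@set_idx n (T w)))) ^+ 2)%:E)%E =
    (\int[P]_w (err (S w, T w))%:E)%E.
  by apply: eq_integral => w _; rewrite frobenius_normE.
rewrite (@ge0_integral_finType _ _ _ P _ (fun w => (S w, T w)) _ err mST) //; last first.
  by move=> x; exact: sqnorm_ge0.
rewrite frobenius_normE.
(* The sum over pairs is disintegrated along the first sample. *)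
have -> : (\sum_x (err x)%:E * P ([set w | (S w, T w) = x] `&` setT) =
    (\sum_s q s * \sum_t qc s t * err (s, t))%:E)%E.
  rewrite -sumEFin; under [RHS]eq_bigr do rewrite mulr_sumr -sumEFin.
  rewrite pair_bigA; apply: eq_bigr => -[s t] _ /=.
  rewrite mulrA EFinM -jointE muleC setIT; congr (P _ * _)%E.
  by apply/seteqP; split=> w /= [-> ->].
rewrite lee_fin; exact: mean_error_le.
Qed.
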